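(* Let $K$ be a non-Archimedean local field, $n\ge 1$, $f\in\mathcal D(K)$, and let $\omega_1,\ldots,\omega_n\in K$ satisfy $\max_{1\le j\le n}|\omega_j|=1$. Define $F:K\times K^n\to\mathbb C$ by $$F(t,x)=f(t+\omega_1x_1+\cdots+\omega_nx_n),\qquad t\in K,\ x=(x_1,\ldots,x_n)\in K^n.$$ Then for any $\alpha>0$, $$\left(D_t^\alpha F\right)(t,x)-\left(D_x^{\alpha,n}F\right)(t,x)=0\qquad\text{for all } t\in K,\ x\in K^n.$$
   Context: A non-Archimedean local field $K$ is a non-discrete totally disconnected locally compact topological field; $|\cdot|$ is its normalized absolute value, $q$ is the cardinality of the residue field, so $|\cdot|$ takes the values $q^N$ ($N\in\mathbb Z$) and $0$. Haar measure $dx$ on $K$ is normalized so that $\{x\in K:|x|\le1\}$ has measure $1$; $d^nx=dx_1\cdots dx_n$ on $K^n$; $\|x\|=\max_{1\le j\le n}|x_j|$ for $x\in K^n$. A function $f$ on $K$ is called locally constant if there is an integer $l$ such that $f(x+x')=f(x)$ for all $x\in K$ and all $x'$ with $|x'|\le q^{-l}$ (similarly on $K^n$, with $\|\cdot\|$). $\mathcal D(K)$ is the space of complex-valued locally constant functions on $K$ with compact support. For $\alpha>0$ and a bounded locally constant function $u:K\to\mathbb C$, $$(D^\alpha u)(x)=\frac{1-q^\alpha}{1-q^{-\alpha-1}}\int_K|y|^{-\alpha-1}[u(x-y)-u(x)]\,dy ,$$ and for a bounded locally constant function $u:K^n\to\mathbb C$, $$(D^{\alpha,n}u)(x)=\frac{1-q^\alpha}{1-q^{-\alpha-n}}\int_{K^n}\|y\|^{-\alpha-n}[u(x-y)-u(x)]\,d^ny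 .$$ (On $\mathcal D(K)$ and $\mathcal D(K^n)$ these are the pseudo-differential operators with symbols $|\xi|^\alpha$ and $\|\xi\|^\alpha$.) Subscripts in $D_t^\alpha$, $D_x^{\alpha,n}$ indicate the variable on which the operator acts, the other variable being fixed. *)

(* Defs.v *)
From HB Require Import structures.
From mathcomp Require Import all_boot all_order all_algebra.
From mathcomp Require Import all_classical all_reals all_analysis.
From mathcomp Require Import complex.
Import Order.TTheory GRing.Theory Num.Theory.

Set Implicit Arguments.
Unset Strict Implicit.
Unset Printing Implicit Defensive.

Local Open Scope classical_set_scope.
Local Open Scope ring_scope.
Local Open Scope card_scope.
Local Open Scope complex_scope.

HB.mixin Record TopologicalZmodule_isTopologicalField K
    & TopologicalZmodule K & GRing.Field K := {
  fieldmul_continuous : continuous (fun p : K * K => p.1 * p.2) ;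
  fieldinv_continuous : forall x : K, x != 0 -> {for x, continuous (@GRing.inv K)}
}.

#[short(type="topologicalFieldType")]
HB.structure Definition TopologicalField :=
  {K of TopologicalZmodule K & GRing.Field K
        & TopologicalZmodule_isTopologicalField K}.

(* g_sigma_algebraType requires a pointed type. *)
#[non_forgetful_inheritance]
HB.instance Definition _ (K : topologicalFieldType) := isPointed.Build K 0.

Notation borel V := (g_sigma_algebraType (@open V)).

Definition nonarchimedean_local_field (K : topologicalFieldType) : Prop :=
  [/\ ~ (forall A : set K, open A),
      totally_disconnected [set: K] &
      locally_compact [set: K] ].

(* O / P, with O = {|x| <= 1} and P = {|x| < 1}, as the set of cosets x + P. *)
Definition residue_field (R : realType) (K : topologicalFieldType)
    (abs : K -> R) : set (set K) :=
  [set [set y | abs (y - x) < 1] | x in [set x | abs x <= 1]].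

(* The absolute value defining the topology, normalized by |b| = 1/q for a
   generator b of P, where q = #(O / P); these conditions determine it. *)
Record normalized_absval (R : realType) (K : topologicalFieldType)
    (q : nat) (abs : K -> R) : Prop := NormalizedAbsval {
  absval_ge0 : forall x, 0 <= abs x ;
  absval_eq0 : forall x, abs x = 0 <-> x = 0 ;
  absvalM : forall x y, abs (x * y) = abs x * abs y ;
  absval_ultrametric : forall x y, abs (x + y) <= Num.max (abs x) (abs y) ;
  absval_nbhs : forall (x : K) (A : set K),
    nbhs x A <-> exists2 e : R, 0 < e & [set y | abs (y - x) < e] `<=` A ;
  absval_card_residue : residue_field abs #= `I_q ;
  absval_uniformizer : exists2 b : K, abs b = q%:R^-1 &
    [set x | abs x < 1] = [set b * y | y in [set y | abs y <= 1]]
}.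

Definition norm_max (R : realType) (K : topologicalFieldType) (abs : K -> R)
    (n : nat) (x : 'rV[K]_n) : R :=
  \big[Num.max/0]_(j < n) abs (x 0 j).

(* K is second countable, so regularity of mu on Borel sets is automatic. *)
Record normalized_haar (R : realType) (K : topologicalFieldType)
    (abs : K -> R) (mu : {measure set (borel K) -> \bar R}) : Prop :=
  NormalizedHaar {
  haar_translation : forall (x : K) (A : set K),
    measurable (A : set (borel K)) -> mu [set x + y | y in A] = mu A ;
  haar_compact : forall A : set K, compact A -> (mu A < +oo)%E ;
  haar_unit_ball : mu [set x | abs x <= 1] = 1%E
}.

(* d^n x = dx_1 ... dx_n. Since K is second countable and mu sigma-finite, nu is
   the unique measure on the Borel sets of K^n with these values on boxes. *)
Definition is_product_measure (R : realType) (K : topologicalFieldType)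
    (mu : {measure set (borel K) -> \bar R}) (n : nat)
    (nu : {measure set (borel 'rV[K]_n) -> \bar R}) : Prop :=
  forall A : 'I_n -> set K, (forall j, measurable (A j : set (borel K))) ->
    nu [set x : 'rV[K]_n | forall j, A j (x 0 j)] = (\prod_(j < n) mu (A j))%E.

Definition complex_integral (d : measure_display) (T : measurableType d)
    (R : realType) (m : {measure set T -> \bar R}) (g : T -> R[i]) : R[i] :=
  (\int[m]_x complex.Re (g x)) +i* (\int[m]_x complex.Im (g x)).

Definition locally_constant (R : realType) (K : topologicalFieldType)
    (q : nat) (abs : K -> R) (f : K -> R[i]) : Prop :=
  exists l : int, forall x x' : K,
    abs x' <= q%:R ^ (- l) -> f (x + x') = f x.

(* The space D(K). *)
Definition test_function (R : realType) (K : topologicalFieldType)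
    (q : nat) (abs : K -> R) (f : K -> R[i]) : Prop :=
  locally_constant q abs f /\ compact (closure [set x | f x != 0]).

(* The kernel takes a junk value at y = 0, where the difference vanishes. *)
Definition frac_diff (R : realType) (K : topologicalFieldType)
    (q : nat) (abs : K -> R) (mu : {measure set (borel K) -> \bar R})
    (alpha : R) (u : K -> R[i]) (x : K) : R[i] :=
  ((1 - q%:R `^ alpha) / (1 - q%:R `^ (- alpha - 1)))%:C *
  complex_integral mu
    (fun y : K => (abs y `^ (- alpha - 1))%:C * (u (x - y) - u x)).

Definition frac_diff_n (R : realType) (K : topologicalFieldType)
    (q : nat) (abs : K -> R) (n : nat)
    (nu : {measure set (borel 'rV[K]_n) -> \bar R})
    (alpha : R) (u : 'rV[K]_n -> R[i]) (x : 'rV[K]_n) : R[i] :=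
  ((1 - q%:R `^ alpha) / (1 - q%:R `^ (- alpha - n%:R)))%:C *
  complex_integral nu
    (fun y : 'rV[K]_n =>
       (norm_max abs y `^ (- alpha - n%:R))%:C * (u (x - y) - u x)).

(* Main.v *)
Require Import Defs.
From HB Require Import structures.
From mathcomp Require Import all_boot all_order all_algebra.
From mathcomp Require Import all_classical all_reals all_analysis.
From mathcomp Require Import measurable_realfun complex.
From mathcomp Require Import ring lra zify.
Import Order.TTheory GRing.Theory Num.Theory.
Import numFieldNormedType.Exports.

Set Implicit Arguments.
Unset Strict Implicit.
Unset Printing Implicit Defensive.

Local Open Scope classical_set_scope.
Local Open Scope ring_scope.
Local Open Scope complex_scope.

(** With [s0 = t + omega . x] and [g z = f (s0 - z) - f s0], the two operators
    integrate [g] against [|z|^(-alpha-1)] over [K] and [g (omega . y)] against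
    [||y||^(-alpha-n)] over [K^n].  The function [g] is locally constant and
    vanishes on a ball [|z| <= q^k].

    A negative power of the norm is a superposition of indicators of balls:
    summing a geometric series,
      [N^p = (1 - q^p) * sum_(l such that N <= q^l) q^(p * l)]
    whenever [N] is a power of [q].  Hence ([layer_cake_integral])
      [int N^p h = (1 - q^p) * sum_(l >= k) q^(p * l) * int_(N <= q^l) h],
    and [1 - q^p] is exactly the denominator in the normalization of the
    operators.  It remains to compare the integrals over balls.  Since
    [max |omega_j| = 1], the map [y |-> omega . y] sends the ball of radius
    [q^l] of [K^n] onto that of [K], with all fibres of the same volume
    [(q^l)^(n-1)], so that ([integral_dot_ball])
      [int_(||y|| <= q^l) h (omega . y) = (q^l)^(n-1) * int_(|z| <= q^l) h],
    and [q^(-alpha-n) * q^(n-1) = q^(-alpha-1)]: both operators are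
    [1 - q^alpha] times the same series ([kernel_Rintegrals]).

    The comparison over balls is a finite count.  A ball of radius [q^l] is a
    finite disjoint union of cosets of the ball of radius [q^k], on each of
    which [h] is constant, and the part of the ball of [K^n] on which
    [omega . y] lies in a given coset is a finite disjoint union of boxes
    ([strip_measure]), whose volumes are those prescribed by the product
    measure.  Splitting [g] into the positive and negative parts of its real
    and imaginary parts reduces everything to nonnegative functions, for which
    sums and integrals commute. *)

(** * Negative powers of a norm as series of indicators of balls *)

Lemma gt1_powR_lt1 (R : realType) (x p : R) : 1 < x -> p < 0 -> x `^ p < 1.
Proof.
move=> x1 p0; rewrite -[p]opprK powRN invf_lt1; last first.
  by rewrite powR_gt0// (lt_trans ltr01).
have Np0 : 0 < - p by rewrite oppr_gt0.
have := gt0_ltr_powR Np0 _ _ x1; rewrite powR1; apply; rewrite nnegrE//.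
exact/ltW/(lt_trans ltr01).
Qed.

Section layer_cake.
Context d (T : measurableType d) (R : realType).
Variable m : {measure set T -> \bar R}.

(** The partial sums telescope to [a ^ j - a ^ (max j i)]. *)
Lemma tail_geometric_series (a : R) (j : nat) : 0 < a -> a < 1 ->
  (\sum_(i <oo) (if (j <= i)%N then (1 - a) * a ^+ i else 0)%:E)%E
  = (a ^+ j)%:E.
Proof.
move=> a0 a1; apply/cvg_lim => //.
have E i : (\sum_(0 <= k < i) (if (j <= k)%N then (1 - a) * a ^+ k else 0)%:E)%E
    = (a ^+ j - a ^+ maxn j i)%:E.
  elim: i => [|i IH]; first by rewrite big_geq// maxn0 subrr.
  rewrite big_nat_recr//= IH -EFinD; congr EFin.
  case: leqP => ji.
    by rewrite (maxn_idPr (leqW ji)) exprS; ring.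
  by rewrite (maxn_idPl ji) addr0.
rewrite (funext E); apply: cvg_EFin; first by near=> i.
rewrite -[X in _ --> X]subr0; apply: cvgB; first exact: cvg_cst.
have H : a ^+ i @[i --> \oo] --> 0 by apply: cvg_expr; rewrite ger0_norm// ltW.
apply: cvg_trans H; apply: near_eq_cvg; near=> i.
by rewrite (_ : maxn j i = i)//; apply/maxn_idPr; near: i; exists j.
Unshelve. all: by end_near. Qed.

(** Where [h] does not vanish, [N y = Q ^ (k + j)] for some natural [j], and
    [N y] raised to [p] is the tail from [j] on of the geometric series of
    ratio [Q `^ p]; the ball of radius [Q ^ (k + i)] contains [y] exactly when
    [j <= i], so this tail is a series of indicators of balls, integrated term
    by term by monotone convergence. *)
Lemma layer_cake_integral (Q : R) (N h : T -> R) (p : R) (k : int) :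
  1 < Q -> p < 0 ->
  (forall y, N y = 0 \/ exists l : int, N y = Q ^ l) ->
  (forall l : int, measurable [set y | N y <= Q ^ l]) ->
  measurable_fun setT h -> (forall y, 0 <= h y) ->
  (forall y, N y <= Q ^ k -> h y = 0) ->
  (\int[m]_y (N y `^ p * h y)%:E =
   (1 - Q `^ p)%:E * \sum_(i <oo) ((Q `^ p) ^ (k + i%:Z))%:E *
     \int[m]_(y in [set y | (N y <= Q ^ (k + i%:Z))%R]) (h y)%:E)%E.
Proof.
move=> Q1 p0 NV mB mh h0 hk; have Q0 : 0 < Q by lra.
set a := Q `^ p.
have a0 : 0 < a by apply: powR_gt0.
have a1 : a < 1 by exact: gt1_powR_lt1.
pose B i := [set y | (N y <= Q ^ (k + i%:Z))%R].
pose g i y : \bar R := ((1 - a) * (a ^ (k + i%:Z)) * (h y * \1_(B i) y))%:E.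
have pw y : (N y `^ p * h y)%:E = (\sum_(i <oo) g i y)%E.
  have [hy|hy] := eqVneq (h y) 0.
    by rewrite hy mulr0 eseries0// => i _ _; rewrite /g hy mul0r mulr0.
  have Nk : Q ^ k < N y.
    by rewrite ltNge; apply/negP => /hk/eqP; apply/negP.
  have [Ny0|[l Nl]] := NV y.
    by move: Nk; rewrite Ny0 ltNge exprz_ge0// ltW.
  have kl : k < l by move: Nk; rewrite Nl ltr_eXz2l.
  set j := `|l - k|%N; have lE : l = k + j%:Z by rewrite /j gez0_abs; lia.
  rewrite Nl -powR_intmul; last exact: ltW.
  rewrite powRAC powR_intmul ?(ltW a0)// lE expfzDr ?gt_eqF//.
  rewrite -exprnP mulrAC EFinM -(tail_geometric_series j a0 a1).
  rewrite -nneseriesZl => [|i _]; last first.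
    rewrite lee_fin; case: ifP => // _.
    by rewrite mulr_ge0// ?exprn_ge0 ?subr_ge0 ?(ltW a0) ?(ltW a1).
  apply: eq_eseriesr => i _; rewrite /g -EFinM indicE expfzDr ?gt_eqF//.
  have -> : (y \in B i) = (j <= i)%N.
    apply/idP/idP; by rewrite inE /B/= Nl lE ler_eXz2l//; lia.
  congr EFin; case: ifP => _; last by rewrite !mulr0.
  by rewrite -exprnP mulr1n; ring.
transitivity (\int[m]_y (\sum_(i <oo) g i y)%E)%E.
  by apply: eq_integral => y _; exact: pw.
have c0 i : 0 <= (1 - a) * a ^ (k + i%:Z).
  by rewrite mulr_ge0 ?exprz_ge0 ?subr_ge0 ?(ltW a0) ?(ltW a1).
have mhB i : measurable_fun setT (fun y => h y * \1_(B i) y).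
  by apply: measurable_funM => //; apply: measurable_indic; exact: mB.
rewrite integral_nneseries//; last 2 first.
- move=> i; apply/measurable_EFinP; apply: measurable_funM => //.
- by move=> i y _; rewrite lee_fin mulr_ge0// mulr_ge0.
rewrite -nneseriesZl => [|i _]; last first.
  rewrite mule_ge0 ?lee_fin ?exprz_ge0 ?(ltW a0)// integral_ge0// => y _.
  by rewrite lee_fin.
apply: eq_eseriesr => i _.
rewrite muleA -EFinM [in RHS]integral_mkcond -ge0_integralZl_EFin//.
- apply: eq_integral => y _; rewrite /g EFinM; congr (_ * _)%E.
  by rewrite patchE indicE -/(B i); case: (y \in B i); rewrite ?mulr1 ?mulr0.
- by move=> y _; rewrite patchE; case: ifP; rewrite // lee_fin.
- apply/(measurable_restrictT _ _).1; [exact: mB|].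
  apply/measurable_EFinP; exact: measurable_funTS.
Qed.

End layer_cake.

(** * Finite partitions *)

Section partition.
Context d (T : measurableType d) (R : realType).
Variable m : {measure set T -> \bar R}.

Lemma ge0_integral_partition (I : finType) (A : set T) (E : I -> set T)
    (h : T -> R) (c : I -> R) :
  (forall i, measurable (E i)) ->
  (forall y, A y -> exists! i, E i y) ->
  (forall i y, E i y -> A y /\ h y = c i) ->
  measurable_fun setT h -> (forall y, 0 <= h y) ->
  (\int[m]_(y in A) (h y)%:E = \sum_(i : I) (c i)%:E * m (E i))%E.
Proof.
move=> mE AE EA mh h0.
have -> : A = \big[setU/set0]_(i <- index_enum I) E i.
  apply/seteqP; split => y.
    move=> /AE[i [Ei _]]; rewrite -bigcup_seq; exists i => //=.
    exact: mem_index_enum.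
  by rewrite -bigcup_seq => -[i _ /EA[]].
rewrite ge0_integral_bigsetU//.
- apply: eq_bigr => i _; rewrite -integral_cst//; apply: eq_integral => y.
  by rewrite inE => /EA[_ ->].
- exact: index_enum_uniq.
- move=> i j _ _ [y [Ei Ej]].
  have [k [_ ku]] := AE y (proj1 (EA _ _ Ei)).
  by rewrite -(ku i)// -(ku j).
- apply: measurable_funTS; exact/measurable_EFinP.
- by move=> y _; rewrite lee_fin.
Qed.

Lemma measure_partition (I : finType) (A : set T) (E : I -> set T) :
  (forall i, measurable (E i)) -> measurable A ->
  (forall y, A y -> exists! i, E i y) ->
  (forall i y, E i y -> A y) ->
  (m A = \sum_(i : I) m (E i))%E.
Proof.
move=> mE mA AE EA.
rewrite -[LHS]mul1e -(integral_cst m mA).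
rewrite (@ge0_integral_partition I A E (cst 1) (cst 1))//.
  by apply: eq_bigr => i _; rewrite mul1e.
by move=> i y /EA.
Qed.
End partition.

(** * The absolute value and its balls *)

Section absolute_value.
Variables (R : realType) (K : topologicalFieldType) (q : nat) (abs : K -> R).
Hypothesis habs : normalized_absval q abs.
Notation Q := (q%:R : R).

Let abs_ge0 := absval_ge0 habs.

Lemma abs0 : abs 0 = 0.
Proof. exact/(absval_eq0 habs). Qed.

Lemma abs_gt0 x : x != 0 -> 0 < abs x.
Proof.
move=> x0; rewrite lt0r abs_ge0 andbT.
by apply: contra x0 => /eqP/(absval_eq0 habs) ->.
Qed.

Lemma abs1 : abs 1 = 1.
Proof.
have := absvalM habs 1 1; rewrite mulr1 => /esym/eqP.
rewrite -[X in _ == X]mulr1 => /eqP/mulfI; apply.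
by rewrite gt_eqF// abs_gt0// oner_neq0.
Qed.

Lemma absV x : abs x^-1 = (abs x)^-1.
Proof.
have [->|x0] := eqVneq x 0; first by rewrite invr0 abs0 invr0.
apply: (@mulfI _ (abs x)); first by rewrite gt_eqF// abs_gt0.
by rewrite -(absvalM habs) !divff// ?abs1// gt_eqF// abs_gt0.
Qed.

Lemma absN x : abs (- x) = abs x.
Proof.
suff H : abs (-1) = 1 by rewrite -mulN1r (absvalM habs) H mul1r.
have := absvalM habs (-1) (-1); rewrite mulrNN mulr1 abs1 => /esym/eqP.
rewrite -expr2 -[X in _ == X](expr1n _ 2) eqf_sqr => /orP[/eqP//|/eqP H].
by have := abs_ge0 (-1); rewrite H; lra.
Qed.

Lemma absD_le x y r : abs x <= r -> abs y <= r -> abs (x + y) <= r.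
Proof.
move=> xr yr; apply: (le_trans (absval_ultrametric habs x y)).
by rewrite ge_max xr.
Qed.

Lemma absB_le x y r : abs x <= r -> abs y <= r -> abs (x - y) <= r.
Proof. by move=> xr yr; apply: absD_le; rewrite ?absN. Qed.

Lemma absBC x y : abs (x - y) = abs (y - x).
Proof. by rewrite -absN opprB. Qed.

Lemma abs_sum_le (I : finType) (F : I -> K) r :
  0 <= r -> (forall i, abs (F i) <= r) -> abs (\sum_i F i) <= r.
Proof.
move=> r0 Fr; elim/big_ind: _ => //; first by rewrite abs0.
by move=> x y; exact: absD_le.
Qed.

(** The maximal ideal is generated by an element of absolute value [1/q], so
    no value lies strictly between [1/q] and [1]. *)
Lemma abs_lt1 x : abs x < 1 <-> abs x <= Q^-1.
Proof.
have [b bq Eb] := absval_uniformizer habs.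
have b1 : abs b < 1.
  suff : [set x | abs x < 1] b by [].
  by rewrite Eb; exists 1; rewrite ?mulr1//= abs1.
split=> xq; last by rewrite (le_lt_trans xq)// -bq.
have : [set x | abs x < 1] x by [].
by rewrite Eb => -[y /= y1 <-]; rewrite (absvalM habs) bq ler_piMr// -bq.
Qed.

Lemma abs_exprz (b : K) (k : int) : abs (b ^ k) = abs b ^ k.
Proof.
have X (n : nat) : abs (b ^+ n) = abs b ^+ n.
  elim: n => [|n IH]; first by rewrite !expr0 abs1.
  by rewrite !exprS (absvalM habs) IH.
by case: k => n; rewrite /exprz ?absV X.
Qed.

(** The uniformizer lies in the maximal ideal, so its absolute value [1/q] is
    smaller than [1]; and [q] is not [0] because the maximal ideal is itself an
    element of the residue field. *)
Lemma residue_card_gt1 : 1 < Q.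
Proof.
have [b bq Eb] := absval_uniformizer habs.
have : Q^-1 < 1.
  suff : [set x | abs x < 1] b by rewrite /= bq.
  by rewrite Eb; exists 1; rewrite ?mulr1//= abs1.
have : 0 < Q.
  rewrite ltr0n lt0n; apply/negP => /eqP q0.
  have := absval_card_residue habs; rewrite q0 II0 card_eq0 => /eqP E.
  suff : @set0 (set K) [set y | abs (y - 0) < 1] by [].
  by rewrite -E; exists 0; rewrite //= abs0.
by move=> Q0; rewrite invf_lt1.
Qed.

Let Q_gt1 := residue_card_gt1.
Let Q_gt0 : 0 < Q. Proof. exact: lt_trans Q_gt1. Qed.

Lemma exists_uniformizer :
  exists2 b : K, b != 0 & forall k : int, abs (b ^ k) = Q ^ (- k).
Proof.
have [b bq _] := absval_uniformizer habs; exists b.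
  by apply/eqP => b0; move: bq; rewrite b0 abs0 => /esym/eqP; rewrite invr_eq0 gt_eqF.
by move=> k; rewrite abs_exprz bq exprz_inv.
Qed.

(** If [k] is least with [|x| <= q^k] and [b] is a uniformizer, then
    [1/q < |x b^k| <= 1], and the gap between [1/q] and [1] forces
    [|x b^k| = 1]. *)
Lemma abs_val x : abs x = 0 \/ exists l : int, abs x = Q ^ l.
Proof.
have [->|x0] := eqVneq x 0; first by left; rewrite abs0.
right; have ax := abs_gt0 x0.
have [b b0 bE] := exists_uniformizer.
have lnQ : 0 < ln Q by rewrite ln_gt0.
have lnE (k : int) : ln (Q ^ k) = k%:~R * ln Q.
  by rewrite -powR_intmul ?ln_powR// ltW.
set k := Num.ceil (ln (abs x) / ln Q).
have k2 : abs x <= Q ^ k.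
  by rewrite -ler_ln ?posrE ?exprz_gt0// lnE -ler_pdivrMr// ceil_ge.
have k1 : Q ^ (k - 1) < abs x.
  by rewrite -ltr_ln ?posrE ?exprz_gt0// lnE -ltr_pdivlMr// ceilB1_lt.
have Qk : Q ^ (- k) = (Q ^ k)^-1 by rewrite invr_expz.
exists k; apply/eqP; rewrite eq_le k2 leNgt; apply/negP => k3.
have : abs (x * b ^ k) < 1.
  by rewrite (absvalM habs) bE Qk ltr_pdivrMr ?exprz_gt0// mul1r.
move/abs_lt1; rewrite (absvalM habs) bE Qk ler_pdivrMr ?exprz_gt0//.
by rewrite leNgt mulrC -(exprN1 Q) -expfzDr ?gt_eqF//= k1.
Qed.

(** Representatives, in the ball of radius [q^k'], of the cosets of the ball of
    radius [q^k]. *)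
Definition coset_reps (k k' : int) (I : finType) (r : I -> K) : Prop :=
  (forall i, abs (r i) <= Q ^ k') /\
  (forall x, abs x <= Q ^ k' -> exists! i, abs (x - r i) <= Q ^ k).

(** Multiplication by a power of the uniformizer reduces this to [k + 1 = 0],
    where the cosets are the elements of the residue field. *)
Lemma coset_reps_step (k : int) : exists r : 'I_q -> K, coset_reps k (k + 1) r.
Proof.
have [b b0 bE] := exists_uniformizer.
have [g [gI ginj gsurj]] := elimT card_set_bijP (absval_card_residue habs).
(* [g] numbers the elements of the residue field, which are the sets [C c] *)
pose C c := [set y | abs (y - c) < 1].
have CE c c' : abs (c - c') < 1 -> C c = C c'.
  move=> cc'; have E u v : abs (u - v) < 1 -> C u `<=` C v.
    move=> uv y yu; rewrite /C/= (_ : y - v = (y - u) + (u - v)); last by ring.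
    by rewrite (le_lt_trans (absval_ultrametric habs _ _))// gt_max yu.
  by apply/seteqP; split; apply: E => //; rewrite absBC.
have Cres c : abs c <= 1 -> residue_field abs (C c) by move=> c1; exists c.
have /choice [c cP] : forall i : 'I_q, exists c, abs c <= 1 /\ g (C c) = i :> nat.
  by move=> i; have [_ [c c1 <-] gi] := gsurj i (ltn_ord i); exists c.
have bk0 : b ^ (k + 1) != 0 by rewrite expfz_neq0.
have Qk0 : 0 < Q ^ (k + 1) by rewrite exprz_gt0.
pose r i := c i / b ^ (k + 1).
have absr x : abs (x / b ^ (k + 1)) = abs x * Q ^ (k + 1).
  by rewrite (absvalM habs) absV bE invr_expz opprK.
have absr1 x : abs (x / b ^ (k + 1)) <= Q ^ k <-> abs x < 1.
  rewrite absr -ler_pdivlMr// invr_expz -expfzDr ?gt_eqF// abs_lt1.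
  by rewrite (_ : k - (k + 1) = -1) //; lia.
exists r; split=> [i|x].
  by rewrite absr ler_piMl ?(ltW Qk0)//; have [] := cP i.
rewrite -(mulfK bk0 x); set x' := x * _; rewrite absr.
rewrite -ler_pdivlMr// divff ?gt_eqF// => x'1.
have rE i : x' / b ^ (k + 1) - r i = (x' - c i) / b ^ (k + 1).
  by rewrite mulrBl.
have iP : (g (C x') < q)%N := gI _ (Cres _ x'1).
set i0 := Ordinal iP; have i0E : i0 = g (C x') :> nat by [].
clearbody i0; exists i0; split=> [|i]; rewrite rE; last move/absr1.
  apply/absr1; have [ci gi] := cP i0.
  have CC : C (c i0) = C x' by apply: ginj; rewrite ?inE ?gi//; exact: Cres.
  have : C x' x' by rewrite /C/= subrr abs0.
  by rewrite -CC.
have [ci gi] := cP i => /CE CE'.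
by apply/val_inj; transitivity (g (C x')); [exact: i0E|rewrite CE'].
Qed.

(** Representatives for successive radii add up.  The index type is left
    abstract: its cardinality will be read off from the Haar measure. *)
Lemma coset_reps_exists (k : int) (m : nat) :
  exists (I : finType) (r : I -> K), coset_reps k (k + m%:Z) r.
Proof.
elim: m => [|m [I [r [rk rP]]]].
  exists unit, (fun=> 0); split=> [_|x xk]; first by rewrite abs0 exprz_ge0// ltW.
  by exists tt; split=> [|[]//]; rewrite subr0; move: xk; rewrite addr0.
have [s [sk sP]] := coset_reps_step (k + m%:Z).
have kE : k + m.+1%:Z = k + m%:Z + 1 by lia.
have le_km : Q ^ (k + m%:Z) <= Q ^ (k + m%:Z + 1) by rewrite ler_eXz2l//; lia.
exists ('I_q * I)%type, (fun i => s i.1 + r i.2); rewrite kE; split=> [i|x xk].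
  by apply: absD_le => //; exact: le_trans (rk _) le_km.
have [i [xi iu]] := sP _ xk.
have [j [xj ju]] := rP _ xi.
exists (i, j); split=> [|[i' j'] /= H]; first by rewrite opprD addrA.
have ii' : i = i'.
  apply: iu; rewrite (_ : x - _ = x - (s i' + r j') + r j'); last by ring.
  apply: absD_le => //; apply: le_trans H _.
  by rewrite ler_eXz2l//; lia.
by rewrite -ii' in H *; rewrite (ju j')// -addrA -opprD.
Qed.
End absolute_value.

Section max_norm.
Variables (R : realType) (K : topologicalFieldType) (q : nat) (abs : K -> R).
Hypothesis habs : normalized_absval q abs.
Variable n : nat.
Implicit Types y : 'rV[K]_n.
Notation Q := (q%:R : R).

Lemma norm_max_le y (r : R) : 0 <= r ->
  norm_max abs y <= r <-> forall j, abs (y 0 j) <= r.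
Proof.
move=> r0; split=> [/bigmax_leP[_ H] j|H]; first exact: H.
by apply/bigmax_leP.
Qed.

Lemma norm_max_val y :
  norm_max abs y = 0 \/ exists l : int, norm_max abs y = Q ^ l.
Proof.
rewrite /norm_max; elim/big_ind: _ => [|u v Hu Hv|j _]; first by left.
  by rewrite maxEle; case: ifP.
exact: (abs_val habs).
Qed.

Lemma dot_le (omega : 'I_n -> K) y (r : R) :
  0 <= r -> (forall j, abs (omega j) <= 1) -> norm_max abs y <= r ->
  abs (\sum_(j < n) omega j * y 0 j) <= r.
Proof.
move=> r0 o1 /(norm_max_le _ r0) yr; apply: (abs_sum_le habs) => // j.
by rewrite (absvalM habs) (le_trans _ (yr j))// ler_piMl// (absval_ge0 habs).
Qed.
End max_norm.

(** * Measures of balls and boxes *)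

Section borel.
Variables (R : realType) (K : topologicalFieldType) (q : nat) (abs : K -> R).
Hypothesis habs : normalized_absval q abs.
Variable n : nat.
Notation Q := (q%:R : R).

Let Q0 : 0 < Q.
Proof. exact: lt_trans (residue_card_gt1 habs). Qed.

Let Q_gt0 (k : int) : 0 < Q ^ k.
Proof. exact: exprz_gt0. Qed.

(** A set that is a union of balls of a fixed radius is open.  All measurability
    below comes from here; in particular every preimage by a locally constant
    function is such a set. *)
Lemma borel_ball_stable (k : int) (A : set K) :
  (forall x y, A x -> abs (y - x) <= Q ^ k -> A y) ->
  measurable (A : set (borel K)).
Proof.
move=> HA; apply: sub_sigma_algebra; rewrite openE => x Ax.
apply/(absval_nbhs habs); exists (Q ^ k) => // y /= yx.
by apply: HA Ax _; exact: ltW.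
Qed.

Lemma borel_ball_stable_n (k : int) (A : set 'rV[K]_n) :
  (forall x y, A x -> norm_max abs (y - x) <= Q ^ k -> A y) ->
  measurable (A : set (borel 'rV[K]_n)).
Proof.
move=> HA; apply: sub_sigma_algebra; rewrite openE => x Ax.
exists (fun i j => [set z | abs (z - x i j) < Q ^ k]).
  by move=> i j; apply/(absval_nbhs habs); exists (Q ^ k).
move=> y /= yx; apply: HA Ax _; apply/norm_max_le; first exact: ltW.
by move=> j; rewrite !mxE; exact: ltW.
Qed.

Lemma measurable_locally_constant (k : int) (h : K -> R) :
  (forall x x', abs x' <= Q ^ k -> h (x + x') = h x) ->
  measurable_fun setT (h : borel K -> R).
Proof.
move=> hk _ Y mY; rewrite setTI; apply: (@borel_ball_stable k) => x y /=.
by move=> hx yx; rewrite (_ : y = x + (y - x)) ?hk//; ring.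
Qed.

Lemma measurable_locally_constant_n (k : int) (h : 'rV[K]_n -> R) :
  (forall x x', norm_max abs x' <= Q ^ k -> h (x + x') = h x) ->
  measurable_fun setT (h : borel 'rV[K]_n -> R).
Proof.
move=> hk _ Y mY; rewrite setTI; apply: (@borel_ball_stable_n k) => x y /=.
by move=> hx yx; rewrite (_ : y = x + (y - x)) ?hk// addrC subrK.
Qed.

Lemma borel_ball (c : K) (k : int) :
  measurable ([set y | abs (y - c) <= Q ^ k] : set (borel K)).
Proof.
apply: (@borel_ball_stable k) => x y /= xc yx.
by rewrite -(subrKA x); apply: (absD_le habs).
Qed.

Variable mu : {measure set (borel K) -> \bar R}.
Hypothesis hmu : normalized_haar abs mu.

(** A ball of radius [q^(l+1)] is the disjoint union of [q] translates of the
    ball of radius [q^l], so the measure is multiplied by [q] at each step, in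
    both directions from the unit ball. *)
Lemma haar_ball (k : int) (c : K) : mu [set y | abs (y - c) <= Q ^ k] = (Q ^ k)%:E.
Proof.
pose B c k : set K := [set y | abs (y - c) <= Q ^ k].
have translate c' l : mu (B c' l) = mu (B 0 l).
  rewrite -(haar_translation hmu c' (borel_ball 0 l)).
  congr (mu _); apply/seteqP; split=> y.
    by move=> yc; exists (y - c'); rewrite /B/= ?subr0// addrC subrK.
  by move=> [z /= zl <-]; move: zl; rewrite subr0 /B/= addrAC subrr add0r.
rewrite -/(B c k) translate.
have step l : mu (B 0 (l + 1)) = (Q%:E * mu (B 0%R l))%E.
  have [r [rl rP]] := coset_reps_step habs l.
  rewrite (@measure_partition _ _ _ mu _ _ (fun i => B (r i) l)).
  - under eq_bigr do rewrite translate.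
    by rewrite sumr_const card_ord mule_natl.
  - by move=> i; exact: borel_ball.
  - exact: borel_ball.
  - by move=> y; rewrite /B/= subr0 => /rP.
  - move=> i y; rewrite /B/= subr0 => yi.
    rewrite -(subrK (r i) y); apply: (absD_le habs) => //.
    by rewrite (le_trans yi)// ler_eXz2l ?(residue_card_gt1 habs)//; lia.
elim/int_ind: k => [|m IH|m IH].
- rewrite expr0z -(haar_unit_ball hmu); congr (mu _).
  by apply/seteqP; split=> y; rewrite /B/= subr0.
- rewrite (_ : (m.+1 : int) = m%:Z + 1); last lia.
  by rewrite step IH -EFinM expfzDr ?gt_eqF// mulrC.
- have stepN : mu (B 0 (- m.+1%:Z)) = (Q^-1%:E * mu (B 0%R (- m.+1%:Z + 1)%R))%E.
    by rewrite step muleA -EFinM mulVf ?mul1e// gt_eqF.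
  rewrite stepN (_ : - m.+1%:Z + 1 = - m%:Z); last lia.
  rewrite IH -EFinM -(exprN1 Q) -expfzDr ?gt_eqF//.
  by congr (Q ^ _)%:E; lia.
Qed.

Variable nu : {measure set (borel 'rV[K]_n) -> \bar R}.
Hypothesis hnu : is_product_measure mu nu.

Lemma product_ball (k : int) (c : 'rV[K]_n) :
  nu [set y : 'rV[K]_n | forall j, abs (y 0 j - c 0 j) <= Q ^ k] = ((Q ^ k) ^+ n)%:E.
Proof.
have := hnu (A := fun j => [set y | abs (y - c 0 j) <= Q ^ k])
  (fun j => borel_ball _ _).
move=> /= ->; under eq_bigr do rewrite haar_ball.
by rewrite prodEFin prodr_const card_ord.
Qed.
End borel.

(** * Fibres of the linear form *)

Section linear_form.
Variables (R : realType) (K : topologicalFieldType) (q : nat) (abs : K -> R).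
Hypothesis habs : normalized_absval q abs.
Variable mu : {measure set (borel K) -> \bar R}.
Hypothesis hmu : normalized_haar abs mu.
Variable n : nat.
Variable nu : {measure set (borel 'rV[K]_n.+1) -> \bar R}.
Hypothesis hnu : is_product_measure mu nu.
Variable omega : 'I_n.+1 -> K.
Hypothesis homega : \big[Num.max/0]_(j < n.+1) abs (omega j) = 1.
Notation Q := (q%:R : R).
Notation dot y := (\sum_(j < n.+1) omega j * y 0 j).

Let Q1 : 1 < Q := residue_card_gt1 habs.
Let Q0 : 0 < Q. Proof. exact: lt_trans Q1. Qed.
Let Qk0 (k : int) : 0 < Q ^ k. Proof. exact: exprz_gt0. Qed.

Let omega_le1 j : abs (omega j) <= 1.
Proof. by rewrite -homega; exact: le_bigmax. Qed.

Let omega_unit : exists j0, abs (omega j0) = 1.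
Proof.
apply: contrapT => no1; have := ltxx (1 : R); rewrite -{1}homega.
suff -> : \big[Num.max/0]_(j < n.+1) abs (omega j) < 1 by [].
apply: bigmax_lt => // j _; rewrite lt_neqAle omega_le1 andbT.
by apply/eqP => oj; apply: no1; exists j.
Qed.

Let rowB (x y : 'rV[K]_n.+1) j : (x - y) 0 j = x 0 j - y 0 j.
Proof. by rewrite !mxE. Qed.

Let norm_ball (l : int) (y : 'rV[K]_n.+1) :
  norm_max abs y <= Q ^ l <-> forall j, abs (y 0 j) <= Q ^ l.
Proof. by apply: norm_max_le; exact: ltW. Qed.

Let dot_ball (l : int) (y : 'rV[K]_n.+1) :
  norm_max abs y <= Q ^ l -> abs (dot y) <= Q ^ l.
Proof. by apply: (dot_le habs) => //; exact: ltW. Qed.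

(** Both sides are the Haar measure of the ball of radius [q^(k+m)]. *)
Lemma coset_reps_card (k : int) (m : nat) (I : finType) (r : I -> K) :
  coset_reps q abs k (k + m%:Z) r -> #|I|%:R * Q ^ k = Q ^ (k + m%:Z).
Proof.
move=> [rk rP]; apply: EFin_inj; rewrite -(haar_ball habs hmu _ 0).
rewrite (@measure_partition _ _ _ mu I _ (fun i => [set y | abs (y - r i) <= Q ^ k])).
- under eq_bigr do rewrite (haar_ball habs hmu).
  by rewrite sumr_const EFinM mule_natl.
- by move=> i; exact: borel_ball habs _ _.
- by have := borel_ball habs 0 (k + m%:Z).
- by move=> y /=; rewrite subr0 => /rP.
- move=> i y /=; rewrite subr0 => yi.
  rewrite -(subrK (r i) y); apply: (absD_le habs) => //.
  by rewrite (le_trans yi)// ler_eXz2l//; lia.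
Qed.

Lemma measurable_norm_ball (l : int) :
  measurable ([set y | norm_max abs y <= Q ^ l] : set (borel 'rV[K]_n.+1)).
Proof.
apply: (@borel_ball_stable_n _ _ _ _ habs _ l) => x y /= /norm_ball xl /norm_ball yx.
apply/norm_ball => j; rewrite -(subrK (x 0 j) (y 0 j)); apply: (absD_le habs) => //.
by have := yx j; rewrite rowB.
Qed.

Lemma dotB (x y : 'rV[K]_n.+1) : dot (x - y) = dot x - dot y.
Proof. by rewrite -sumrB; apply: eq_bigr => j _; rewrite !mxE mulrBr. Qed.

Lemma dotD (x y : 'rV[K]_n.+1) : dot (x + y) = dot x + dot y.
Proof. by rewrite -big_split; apply: eq_bigr => j _; rewrite !mxE mulrDr. Qed.

Lemma measurable_strip (k : int) (l : int) (c : K) :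
  measurable ([set y | norm_max abs y <= Q ^ l /\ abs (dot y - c) <= Q ^ k]
    : set (borel 'rV[K]_n.+1)).
Proof.
apply: (@measurableI _ (borel 'rV[K]_n.+1) [set y | norm_max abs y <= Q ^ l]
  [set y | abs (dot y - c) <= Q ^ k]); first exact: measurable_norm_ball.
apply: (@borel_ball_stable_n _ _ _ _ habs _ k) => x y /= xc yx.
rewrite -(subrKA (dot x)) -dotB; apply: (absD_le habs) => //.
exact: dot_ball.
Qed.

(** Fix [j0] with [|omega_j0| = 1].  In the ball, choosing freely the cosets of
    the coordinates other than [j0] and requiring [omega . y] to lie in the
    coset of [c] determines the coset of the coordinate [j0].  So the strip is
    the disjoint union of [N^n] boxes of volume [(q^k)^(n+1)], where
    [N = q^m] is the number of cosets ([n + 1] being the dimension). *)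
Lemma strip_measure (k : int) (m : nat) (c : K) : abs c <= Q ^ (k + m%:Z) ->
  nu [set y | norm_max abs y <= Q ^ (k + m%:Z) /\ abs (dot y - c) <= Q ^ k]
  = ((Q ^ (k + m%:Z)) ^+ n * Q ^ k)%:E.
Proof.
move=> ck; set l := k + m%:Z.
have kl : Q ^ k <= Q ^ l by rewrite ler_eXz2l//; lia.
have [I [r rP]] := coset_reps_exists habs k m.
rewrite -/l in rP ck.
have [j0 oj0] := omega_unit.
have o0 : omega j0 != 0.
  by apply/eqP => o0; move: oj0; rewrite o0 (abs0 habs) => /eqP; rewrite eq_sym oner_eq0.
(* [v d] is the centre of the box attached to the choice [d] of cosets; its
   coordinate [z d] at [j0] solves [omega . v d = c]. *)
pose z (d : {ffun 'I_n -> I}) :=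
  (c - \sum_(i < n) omega (lift j0 i) * r (d i)) / omega j0.
pose v (d : {ffun 'I_n -> I}) : 'rV[K]_n.+1 :=
  \row_j (if unlift j0 j is Some i then r (d i) else z d).
have dotE (y : 'rV[K]_n.+1) :
    dot y = omega j0 * y 0 j0 + \sum_(i < n) omega (lift j0 i) * y 0 (lift j0 i).
  rewrite (bigD1 j0)//=; congr (_ + _).
  rewrite (reindex_omap (lift j0) (unlift j0)) /=; last first.
    move=> j; case: (unliftP j0 j) => [i|] ->//; by rewrite eqxx.
  by apply: eq_bigl => i; rewrite liftK eqxx eq_sym neq_lift.
have v0 d : v d 0 j0 = z d by rewrite mxE unlift_none.
have vS d i : v d 0 (lift j0 i) = r (d i) by rewrite mxE liftK.
have dotv d : dot (v d) = c.
  rewrite dotE v0 /z mulrC divfK//; under [in X in _ + X]eq_bigr do rewrite vS.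
  by rewrite subrK.
have vl d : norm_max abs (v d) <= Q ^ l.
  apply/norm_ball => j; case: (unliftP j0 j) => [i|] ->; first by rewrite vS; exact: rP.1.
  rewrite v0 /z (absvalM habs) (absV habs) oj0 invr1 mulr1.
  apply: (absB_le habs) => //; apply: (abs_sum_le habs) => [|i]; first exact: ltW.
  rewrite (absvalM habs) -[leRHS]mul1r; apply: ler_pM; rewrite ?(absval_ge0 habs)//.
  exact: rP.1.
have box d (y : 'rV[K]_n.+1) : (forall j, abs (y 0 j - v d 0 j) <= Q ^ k) <->
    norm_max abs (y - v d) <= Q ^ k.
  rewrite norm_ball; by split=> H j; have := H j; rewrite rowB.
rewrite (@measure_partition _ _ _ nu {ffun 'I_n -> I} _
  (fun d => [set y : 'rV[K]_n.+1 | forall j, abs (y 0 j - v d 0 j) <= Q ^ k])).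
- under eq_bigr do rewrite (product_ball habs hmu hnu).
  rewrite sumr_const.
  transitivity (#|{ffun 'I_n -> I}|%:R%:E * ((Q ^ k) ^+ n.+1)%:E)%E; first by rewrite mule_natl.
  rewrite -EFinM; congr EFin.
  by rewrite card_ffun card_ord natrX exprSr mulrA -exprMn (coset_reps_card rP).
- move=> d; apply: (@borel_ball_stable_n _ _ _ _ habs _ k) => x y /= xv /norm_ball yx j.
  rewrite -(subrKA (x 0 j)); apply: (absD_le habs) => //.
  by have := yx j; rewrite rowB.
- exact: measurable_strip.
- move=> y /= [yl yc].
  have /choice[d dP] : forall i, exists a,
     unique (fun b => abs (y 0 (lift j0 i) - r b) <= Q ^ k) a.
    by move=> i; have [a aP] := rP.2 _ ((norm_ball _ _).1 yl (lift j0 i)); exists a.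
  exists (finfun d); split=> [j|d' d'P].
    case: (unliftP j0 j) => [i|] ->; first by rewrite vS ffunE; case: (dP i).
    set D := finfun d.
    have : abs (omega j0 * (y 0 j0 - v D 0 j0)) <= Q ^ k.
      have -> : omega j0 * (y 0 j0 - v D 0 j0) = (dot y - c) -
          \sum_(i < n) omega (lift j0 i) * (y 0 (lift j0 i) - v D 0 (lift j0 i)).
        rewrite -(dotv D) -dotB dotE rowB; under [X in _ + X - _]eq_bigr do rewrite rowB.
        by rewrite addrK.
      apply: (absB_le habs) => //; apply: (abs_sum_le habs) => [|i]; first exact: ltW.
      rewrite (absvalM habs) -[leRHS]mul1r; apply: ler_pM; rewrite ?(absval_ge0 habs)//.
      by rewrite vS ffunE; case: (dP i).
    by rewrite (absvalM habs) oj0 mul1r.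
  apply/ffunP => i; rewrite ffunE; apply: (dP i).2.
  by have := d'P (lift j0 i); rewrite vS.
- move=> d y /= /box yv; split.
    apply/norm_ball => j; rewrite -(subrK (v d 0 j) (y 0 j)); apply: (absD_le habs).
      by apply: le_trans kl; apply: (box d y).2.
    by move/norm_ball: (vl d).
  rewrite -(dotv d) -dotB; exact: dot_ball.
Qed.

(** On both sides the ball is cut into finitely many pieces on which the
    integrand is constant: cosets in [K], and the corresponding strips in
    [K^n]. *)
Lemma integral_dot_ball (h : K -> R) (k : int) (m : nat) :
  (forall x, 0 <= h x) -> (forall x x', abs x' <= Q ^ k -> h (x + x') = h x) ->
  (\int[nu]_(y in [set y | (norm_max abs y <= Q ^ (k + m%:Z))%R]) (h (dot y))%:E =
   ((Q ^ (k + m%:Z)) ^+ n)%:E *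
     \int[mu]_(x in [set x | (abs x <= Q ^ (k + m%:Z))%R]) (h x)%:E)%E.
Proof.
move=> h0 hk; set l := k + m%:Z.
have kl : Q ^ k <= Q ^ l by rewrite ler_eXz2l//; lia.
have [I [r rP]] := coset_reps_exists habs k m.
rewrite -/l in rP.
rewrite (@ge0_integral_partition _ _ _ mu I _ (fun i => [set y | abs (y - r i) <= Q ^ k])
  h (h \o r))//; first last.
- exact: (measurable_locally_constant habs hk).
- move=> i y /= yi; split.
    rewrite -(subrK (r i) y); apply: (absD_le habs); last exact: rP.1.
    exact: le_trans kl.
  by rewrite -(subrKC (r i) y) hk.
- by move=> y /rP.2.
- by move=> i; exact: borel_ball habs _ _.
rewrite (@ge0_integral_partition _ _ _ nu I _ (fun i =>
  [set y | norm_max abs y <= Q ^ l /\ abs (dot y - r i) <= Q ^ k])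
  (fun y => h (dot y)) (h \o r))//; first last.
- apply: (@measurable_locally_constant_n _ _ _ _ habs _ k) => x x' x'k.
  by rewrite dotD hk//; exact: dot_ball.
- move=> i y /= [yl yi]; split=> //.
  by rewrite -(subrKC (r i) (dot y)) hk.
- move=> y /= yl; have [i [yi iu]] := rP.2 (dot y) (dot_ball yl).
  by exists i; split=> // i' [_ /iu].
- by move=> i; exact: measurable_strip.
rewrite ge0_sume_distrr => [|i _]; last first.
  by apply: mule_ge0; rewrite ?measure_ge0// lee_fin; exact: h0.
apply: eq_bigr => i _.
rewrite (haar_ball habs hmu) strip_measure; last exact: rP.1.
by rewrite -!EFinM mulrCA.
Qed.
End linear_form.

(** * The two kernel integrals *)

Lemma Rintegral_weighted d (T : measurableType d) (R : realType)
    (m : {measure set T -> \bar R}) (N u : T -> R) : (forall y, 0 <= N y) ->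
  \int[m]_y (N y * u y) = fine (\int[m]_y (N y * Num.max (u y) 0)%:E
                               - \int[m]_y (N y * Num.max (- u y) 0)%:E).
Proof.
move=> N0; rewrite /Rintegral integralE; congr (fine (_ - _)).
  by apply: eq_integral => y _; rewrite funeposE -EFin_max maxr_pMr// mulr0.
by apply: eq_integral => y _; rewrite funenegE -EFinN -EFin_max maxr_pMr// mulr0 mulrN.
Qed.

(** The factor [c] comes out even when [x] or [y] is infinite, which is why the
    integrals of the positive and negative parts need not be finite. *)
Lemma fine_scaleB (R : realType) (c : R) (x y : \bar R) : 0 < c ->
  fine (c%:E * x - c%:E * y) = c * fine (x - y).
Proof.
by move=> c0; case: x y => [x||] [y||] /=;
  rewrite ?gt0_muley ?gt0_muleNy ?lte_fin//= ?mulr0 ?mulrBr.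
Qed.

Lemma complex_integral_weighted d (T : measurableType d) (R : realType)
    (m : {measure set T -> \bar R}) (N : T -> R) (u : T -> R[i]) (c a b : R) :
  \int[m]_y (N y * complex.Re (u y)) = c * a ->
  \int[m]_y (N y * complex.Im (u y)) = c * b ->
  complex_integral m (fun y => (N y)%:C * u y) = c%:C * (a +i* b).
Proof.
have ReM (r : R) (z : R[i]) : complex.Re (r%:C * z) = r * complex.Re z.
  by case: z => x y /=; rewrite mul0r subr0.
have ImM (r : R) (z : R[i]) : complex.Im (r%:C * z) = r * complex.Im z.
  by case: z => x y /=; rewrite mul0r addr0.
move=> Ea Eb; apply/eqP; rewrite eq_complex ReM ImM /= -Ea -Eb.
by apply/andP; split; apply/eqP; apply: eq_Rintegral => y _; rewrite ?ReM ?ImM.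
Qed.

Lemma exponent_lt0 (R : realType) (alpha : R) (m : nat) :
  0 < alpha -> - alpha - m%:R < 0.
Proof. by move=> a0; rewrite -opprD oppr_lt0 ltr_wpDr. Qed.

Section kernels.
Variables (R : realType) (K : topologicalFieldType) (q : nat) (abs : K -> R).
Hypothesis habs : normalized_absval q abs.
Variable mu : {measure set (borel K) -> \bar R}.
Hypothesis hmu : normalized_haar abs mu.
Variable n : nat.
Variable nu : {measure set (borel 'rV[K]_n.+1) -> \bar R}.
Hypothesis hnu : is_product_measure mu nu.
Variable omega : 'I_n.+1 -> K.
Hypothesis homega : \big[Num.max/0]_(j < n.+1) abs (omega j) = 1.
Variable alpha : R.
Hypothesis halpha : 0 < alpha.
Notation Q := (q%:R : R).
Notation dot y := (\sum_(j < n.+1) omega j * y 0 j).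

Let Q1 : 1 < Q := residue_card_gt1 habs.
Let Q0 : 0 < Q. Proof. exact: lt_trans Q1. Qed.

Let exp1_lt0 : - alpha - 1 < 0.
Proof. exact: (exponent_lt0 1 halpha). Qed.

Let expn_lt0 : - alpha - n.+1%:R < 0.
Proof. exact: exponent_lt0. Qed.

(* The weight in [K^n] times the volume of the fibres is the weight in [K]. *)
Let pow_shift (l : int) :
  (Q `^ (- alpha - n.+1%:R)) ^ l * (Q ^ l) ^+ n = (Q `^ (- alpha - 1)) ^ l.
Proof.
have -> : - alpha - 1 = - alpha - n.+1%:R + n%:R :> R by rewrite -natr1; ring.
rewrite [in RHS]powRD; last by rewrite (gt_eqF Q0) implybT.
by rewrite powR_mulrn ?(ltW Q0)// expfzMl exprnP exprzAC.
Qed.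

(** [S] is the common series
    [sum_(l >= k) q^((-alpha-1) * l) * int_(|z| <= q^l) h]. *)
Lemma ge0_kernel_integrals (h : K -> R) (k : int) :
  (forall x, 0 <= h x) -> (forall x x', abs x' <= Q ^ k -> h (x + x') = h x) ->
  (forall x, abs x <= Q ^ k -> h x = 0) ->
  exists S : \bar R,
    (\int[mu]_x (abs x `^ (- alpha - 1) * h x)%:E =
      (1 - Q `^ (- alpha - 1))%:E * S)%E /\
    (\int[nu]_y (norm_max abs y `^ (- alpha - n.+1%:R) * h (dot y))%:E =
      (1 - Q `^ (- alpha - n.+1%:R))%:E * S)%E.
Proof.
move=> h0 hk hB.
have omega_le1 j : abs (omega j) <= 1 by rewrite -homega; exact: le_bigmax.
have Qk0 (l : int) : 0 <= Q ^ l by rewrite exprz_ge0// ltW.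
have dotk (y : 'rV[K]_n.+1) : norm_max abs y <= Q ^ k -> abs (dot y) <= Q ^ k.
  exact: (dot_le habs).
exists (\sum_(i <oo) ((Q `^ (- alpha - 1)) ^ (k + i%:Z))%:E *
     \int[mu]_(y in [set y | (abs y <= Q ^ (k + i%:Z))%R]) (h y)%:E)%E.
split.
  apply: (@layer_cake_integral _ (borel K)) => //.
  - exact: (abs_val habs).
  - by move=> l; have := borel_ball habs 0 l; under eq_set do rewrite subr0.
  - exact: (measurable_locally_constant habs hk).
have mdot : measurable_fun setT (fun y : borel 'rV[K]_n.+1 => h (dot y)).
  apply: (@measurable_locally_constant_n _ _ _ _ habs _ k) => x x' x'k.
  by rewrite dotD hk//; exact: dotk.
have hdot y : norm_max abs y <= Q ^ k -> h (dot y) = 0 by move=> /dotk; exact: hB.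
have mball (l : int) :
    measurable ([set y | norm_max abs y <= Q ^ l] : set (borel 'rV[K]_n.+1)).
  exact: (measurable_norm_ball habs).
apply: (etrans (layer_cake_integral nu Q1 expn_lt0 (norm_max_val habs (n := n.+1)) mball
  mdot (fun y => h0 _) hdot)).
apply: (congr1 (fun S => _ * S)%E); apply: eq_eseriesr => i _.
have dotE := integral_dot_ball habs hmu hnu homega i h0 hk.
by rewrite [X in (_ * X)%E]dotE muleA -EFinM pow_shift.
Qed.

Lemma kernel_Rintegrals (h : K -> R) (k : int) :
  (forall x x', abs x' <= Q ^ k -> h (x + x') = h x) ->
  (forall x, abs x <= Q ^ k -> h x = 0) ->
  exists s : R,
    \int[mu]_x (abs x `^ (- alpha - 1) * h x) = (1 - Q `^ (- alpha - 1)) * s /\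
    \int[nu]_y (norm_max abs y `^ (- alpha - n.+1%:R) * h (dot y)) =
      (1 - Q `^ (- alpha - n.+1%:R)) * s.
Proof.
move=> hk hB.
have [|||Sp [mup nup]] := @ge0_kernel_integrals (fun x => Num.max (h x) 0) k.
- by move=> x; rewrite le_max lexx orbT.
- by move=> x x' /hk ->.
- by move=> x /hB ->; rewrite maxxx.
have [|||Sn [mun nun]] := @ge0_kernel_integrals (fun x => Num.max (- h x) 0) k.
- by move=> x; rewrite le_max lexx orbT.
- by move=> x x' /hk ->.
- by move=> x /hB ->; rewrite oppr0 maxxx.
exists (fine (Sp - Sn)); rewrite !Rintegral_weighted => [|y|y]; try exact: powR_ge0.
by rewrite mup nup mun nun !fine_scaleB// subr_gt0 gt1_powR_lt1.
Qed.
End kernels.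

Theorem proposition2 (R : realType) (K : topologicalFieldType)
    (hK : nonarchimedean_local_field K)
    (q : nat) (abs : K -> R) (habs : normalized_absval q abs)
    (mu : {measure set (borel K) -> \bar R}) (hmu : normalized_haar abs mu)
    (n : nat) (hn : (1 <= n)%N)
    (nu : {measure set (borel 'rV[K]_n) -> \bar R})
    (hnu : is_product_measure mu nu)
    (f : K -> R[i]) (hf : test_function q abs f)
    (omega : 'I_n -> K)
    (homega : \big[Num.max/0]_(j < n) abs (omega j) = 1)
    (F : K -> 'rV[K]_n -> R[i])
    (hF : forall t x, F t x = f (t + \sum_(j < n) omega j * x 0 j))
    (alpha : R) (halpha : 0 < alpha) (t : K) (x : 'rV[K]_n) :
  frac_diff q abs mu alpha (fun s => F s x) t
    - frac_diff_n q abs nu alpha (fun z => F t z) x = 0.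
Proof.
case: n hn nu hnu omega homega F hF x => // n _ nu hnu omega homega F hF x.
have [[l fl] _] := hf.
set s0 := t + \sum_(j < n.+1) omega j * x 0 j.
pose g z := f (s0 - z) - f s0.
have gE z : F (t - z) x - F t x = g z by rewrite !hF /g /s0 addrAC.
have gEn (y : 'rV[K]_n.+1) : F t (x - y) - F t x = g (\sum_(j < n.+1) omega j * y 0 j).
  rewrite !hF /g /s0 -addrA -sumrB; congr (f (_ + _) - _).
  by apply: eq_bigr => j _; rewrite !mxE mulrBr.
have gk z z' : abs z' <= q%:R ^ (- l) -> g (z + z') = g z.
  move=> z'l; rewrite /g (_ : s0 - (z + z') = (s0 - z) + (- z')); last by rewrite opprD addrA.
  by rewrite fl// (absN habs).
have g0 z : abs z <= q%:R ^ (- l) -> g z = 0.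
  by move=> zl; rewrite -(add0r z) (gk _ _ zl) /g subr0 subrr.
have [u [u1 un]] := kernel_Rintegrals habs hmu hnu homega halpha
  (h := fun z => complex.Re (g z)) (fun z z' H => congr1 _ (gk z z' H))
  (fun z H => congr1 _ (g0 z H)).
have [v [v1 vn]] := kernel_Rintegrals habs hmu hnu homega halpha
  (h := fun z => complex.Im (g z)) (fun z z' H => congr1 _ (gk z z' H))
  (fun z H => congr1 _ (g0 z H)).
rewrite /frac_diff /frac_diff_n.
under eq_fun do rewrite gE.
under [in X in _ - X]eq_fun do rewrite gEn.
rewrite (complex_integral_weighted u1 v1) (complex_integral_weighted un vn).
have scale (p : R) (z : R[i]) : p < 0 ->
    ((1 - q%:R `^ alpha) / (1 - q%:R `^ p))%:C * ((1 - q%:R `^ p)%:C * z)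
    = (1 - q%:R `^ alpha)%:C * z.
  move=> p0; rewrite mulrA -rmorphM divfK//.
  by rewrite gt_eqF// subr_gt0 gt1_powR_lt1// (residue_card_gt1 habs).
by rewrite !scale ?subrr//; first [exact: (exponent_lt0 1 halpha)|exact: exponent_lt0].
Qed.
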